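(* Let $\mathcal{F}$ be a free filter on $\omega$. Then the following are equivalent: (i) the Boolean algebra $\mathcal{A}_{\mathcal{F}}=\mathcal{F}\cup\mathcal{F}^*$ has the Nikodym property; (ii) there is no sequence $(\mu_n)_{n\in\omega}$ of non-negative Radon measures on $S_{\mathcal{F}}$ such that (1) $p_{\mathcal{F}}\notin\operatorname{supp}(\mu_n)$ for every $n$, (2) $\sup_n\mu_n(S_{\mathcal{F}})=\infty$, and (3) $\lim_n\mu_n(S_{\mathcal{F}}\setminus U)=0$ for every clopen neighborhood $U$ of $p_{\mathcal{F}}$ in $S_{\mathcal{F}}$; (iii) there is no disjointly supported sequence $(\mu_n)$ of non-negative Radon measures on $S_{\mathcal{F}}$ satisfying (1)–(3).
   Context: A filter $\mathcal{F}$ on $\omega$ is free if $\bigcap\mathcal{F}=\emptyset$; $\mathcal{F}^*=\{\omega\setminus A\colon A\in\mathcal{F}\}$ is the dual ideal, and $\mathcal{A}_{\mathcal{F}}=\mathcal{F}\cup\mathcal{F}^*$ is the Boolean subalgebra of $\wp(\omega)$ generated by $\mathcal{F}$; $\mathcal{F}$ is an ultrafilter of $\mathcal{A}_{\mathcal{F}}$. $S_{\mathcal{F}}$ is the Stone space of $\mathcal{A}_{\mathcal{F}}$ and $p_{\mathcal{F}}\in S_{\mathcal{F}}$ is the point corresponding to the ultrafilter $\mathcal{F}$. A Radon measure on a compact space is a regular $\sigma$-additive bounded Borel measure; $\operatorname{supp}(\mu)$ is the smallest closed set of full $|\mu|$-measure; a sequence is disjointly supported if the supports are pairwise disjoint.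 For a Boolean algebra $\mathcal{A}$, a measure on $\mathcal{A}$ is a bounded finitely additive real function (norm: variation), and $\mathcal{A}$ has the Nikodym property if every sequence of measures on $\mathcal{A}$ converging to $0$ on every element of $\mathcal{A}$ is norm bounded. *)

(* Defs.v *)
From HB Require Import structures.
From mathcomp Require Export all_boot all_order all_algebra.
From mathcomp Require Import finmap.
From mathcomp Require Export all_classical all_reals all_analysis.
Set Implicit Arguments.
Unset Strict Implicit.
Unset Printing Implicit Defensive.
Import Order.TTheory GRing.Theory Num.Theory.
Import numFieldNormedType.Exports.
Local Open Scope classical_set_scope.
Local Open Scope ring_scope.

(* Boolean algebras are given concretely, as systems B of subsets of a type T
   (algebras of sets). *)

Section stone_space.
Context {T : Type}.
Implicit Types B U : set_system T.

Record ultrafilter_on B U : Prop := UltrafilterOn {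
  ultra_on_sub : U `<=` B ;
  ultra_onT : U setT ;
  ultra_on0 : ~ U set0 ;
  ultra_onI : forall A A', U A -> U A' -> U (A `&` A') ;
  ultra_onS : forall A A', U A -> B A' -> A `<=` A' -> U A' ;
  ultra_onC : forall A, B A -> U A \/ U (~` A) }.

Record stone B := Stone {
  stone_ultra : set_system T ;
  stone_ultraP : ultrafilter_on B stone_ultra }.

Lemma stone_eq B (u v : stone B) : stone_ultra u = stone_ultra v -> u = v.
Proof.
case: u v => [u uP] [v vP] /= uv; rewrite uv in uP *.
by rewrite (Prop_irrelevance uP vP).
Qed.

HB.instance Definition _ B := gen_eqMixin (stone B).
HB.instance Definition _ B := gen_choiceMixin (stone B).

Definition stone_clopen B (A : set T) : set (stone B) := 
  [set u : stone B | stone_ultra u A].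

Lemma stone_clopen_cover B : \bigcup_(A in B) @stone_clopen B A = setT.
Proof.
apply/seteqP; split=> // u _; exists setT; last exact: (ultra_onT (stone_ultraP u)).
exact: (ultra_on_sub (stone_ultraP u) (ultra_onT (stone_ultraP u))).
Qed.

Lemma stone_clopen_join B (A A' : set T) (u : stone B) : B A -> B A' ->
  stone_clopen A u -> stone_clopen A' u ->
  exists C, [/\ B C, stone_clopen C u &
    @stone_clopen B C `<=` stone_clopen A `&` stone_clopen A'].
Proof.
move=> BA BA' uA uA'; have uI := ultra_onI (stone_ultraP u) uA uA'.
exists (A `&` A'); split => //; first exact: (ultra_on_sub (stone_ultraP u) uI).
move=> v vI; split.
- by apply: (ultra_onS (stone_ultraP v) vI BA); exact: subIsetl.
- by apply: (ultra_onS (stone_ultraP v) vI BA'); exact: subIsetr.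
Qed.

HB.instance Definition _ B := isBaseTopological.Build (stone B)
  (@stone_clopen_cover B) (@stone_clopen_join B).

Lemma stone_clopenP B (A : set T) : setC_closed B -> B A ->
  clopen (@stone_clopen B A).
Proof.
have op C : B C -> open (@stone_clopen B C).
  by move=> BC; exists [set C]; [move=> ? ->|rewrite bigcup_set1].
move=> BC BA; split; first exact: op.
suff -> : @stone_clopen B A = ~` stone_clopen (~` A).
  by apply: open_closedC; apply: op; exact: BC.
apply/seteqP; split=> u uA.
- move=> uCA; apply: (ultra_on0 (stone_ultraP u)).
  by rewrite -(setICr A); exact: (ultra_onI (stone_ultraP u) uA uCA).
- by case: (ultra_onC (stone_ultraP u) BA).
Qed.

Lemma stone_compact B : B setT -> setI_closed B -> setC_closed B ->
  compact [set: stone B].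
Proof.
move=> BT BI BC; rewrite compact_ultra => G UG _.
have uP : ultrafilter_on B [set A | B A /\ G (@stone_clopen B A)].
  split=> [A []//| | [_] | A A' [BA GA] [BA' GA'] | A A' [BA GA] BA' AA' | A BA].
  - split=> //; apply: filterS filterT => u _; exact: (ultra_onT (stone_ultraP u)).
  - suff -> : @stone_clopen B set0 = set0 by exact: filter_not_empty.
    by apply/seteqP; split=> // u /(ultra_on0 (stone_ultraP u)).
  - split; first exact: BI.
    apply: filterS (filterI GA GA') => u [uA uA'].
    exact: (ultra_onI (stone_ultraP u) uA uA').
  - split=> //; apply: filterS GA => u uA.
    exact: (ultra_onS (stone_ultraP u) uA BA' AA').
  - have [GA|GA] := in_ultra_setVsetC (@stone_clopen B A) UG; [left|right] => //.
    split; first exact: BC.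
    by apply: filterS GA => u uA; case: (ultra_onC (stone_ultraP u) BA).
exists (Stone uP); split=> // V.
rewrite nbhsE => -[W [[D DB <-] [A DA [_ GA]]] WV].
by apply: filterS GA => u uA; apply: WV; exists A.
Qed.

Lemma stone_hausdorff B : setC_closed B -> hausdorff_space (stone B).
Proof.
move=> BC u v uv; apply: stone_eq.
have sub (x y : stone B) : cluster (nbhs x) y -> stone_ultra x `<=` stone_ultra y.
  move=> xy A xA; have BA := ultra_on_sub (stone_ultraP x) xA.
  case: (ultra_onC (stone_ultraP y) BA) => // yCA.
  have nb (z : stone B) C : B C -> stone_ultra z C -> nbhs z (@stone_clopen B C).
    by move=> /(stone_clopenP BC)[oC _] zC; exact: open_nbhs_nbhs.
  have [z [zA zCA]] := xy _ _ (nb x A BA xA) (nb y _ (BC _ BA) yCA).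
  exfalso; apply: (ultra_on0 (stone_ultraP z)).
  by rewrite -(setICr A); exact: (ultra_onI (stone_ultraP z) zA zCA).
by apply/seteqP; split; apply: sub => //; move=> P Q vP uQ; rewrite setIC; exact: uv.
Qed.

End stone_space.

Section nikodym_property.
Context {R : realType} {T : Type}.
Implicit Types (B : set_system T) (m : set T -> R).

(* Only the values of m on members of B are relevant. *)
Definition algebra_measure B m : Prop :=
  (forall A A', B A -> B A' -> A `&` A' = set0 -> m (A `|` A') = m A + m A') /\
  (exists M : R, forall A, B A -> `|m A| <= M).

Definition variation_norm B m : \bar R :=
  ereal_sup [set x | exists n (A : 'I_n -> set T),
    [/\ forall i, B (A i), trivIset setT A & x = (\sum_(i < n) `|m (A i)|)%:E]].

End nikodym_property.

Definition nikodym (R : realType) (T : Type) (B : set_system T) : Prop :=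
  forall m : nat -> set T -> R,
    (forall n, algebra_measure B (m n)) ->
    (forall A, B A -> m n A @[n --> \oo] --> (0 : R)) ->
  exists M : R, forall n, (variation_norm B (m n) <= M%:E)%E.

Notation finite_borel_measure R T :=
  {finite_measure set (g_sigma_algebraType (@open T)) -> \bar R}.

Section radon_measures.
Context {R : realType} {T : ptopologicalType}.
Local Notation borelT := (g_sigma_algebraType (@open T)).
Implicit Types mu : finite_borel_measure R T.
Local Open Scope ereal_scope.

(* Non-negative Radon measures on a compact Hausdorff space T, where closed sets
   and compact sets coincide. *)
Definition radon mu : Prop := forall A : set borelT, measurable A ->
  mu A = ereal_sup [set mu K | K in [set K : set T | closed K /\ K `<=` A]] /\
  mu A = ereal_inf [set mu U | U in [set U : set T | open U /\ A `<=` U]].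

(* For radon mu and compact T this is a closed set of full measure, hence the
   smallest one: see supp_full. *)
Definition supp mu : set T :=
  \bigcap_(C in [set C : set T | closed C /\ mu (~` C) = 0]) C.

Lemma closed_supp mu : closed (supp mu).
Proof. by apply: closed_bigI => C []. Qed.

Lemma supp_full mu : compact [set: T] -> radon mu -> mu (~` supp mu) = 0.
Proof.
move=> cT rmu; have oS : open (~` supp mu) by exact: (closed_openC (@closed_supp mu)).
have mo (U : set T) : open U -> measurable (U : set borelT).
  by move=> oU; exact: sub_sigma_algebra.
have [-> _] := rmu _ (mo _ oS).
apply/eqP; rewrite eq_le; apply/andP; split; last first.
  apply: ereal_sup_ubound; exists set0; last exact: measure0.
  by split; [exact: closed0|exact: sub0set].
apply: ub_ereal_sup => _ [K [cK KS] <-].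
have : compact K by exact: (subclosed_compact cK cT).
rewrite compact_cover => /(_ _ [set U : set T | open U /\ mu U = 0] id).
case=> [U []//|x /KS /existsNP[C /not_implyP[[cC C0] nCx]]|D Dnull KD].
  by exists (~` C) => //; split=> //; exact: closed_openC.
rewrite -(_ : \sum_(U \in [set` D]) mu U = 0).
  apply: (@content_sub_fsum _ _ borelT mu _ _ K id (finite_fset D)) => //.
  - by move=> U /Dnull; rewrite inE => -[oU _]; exact: mo.
  - rewrite -(setCK K); apply: measurableC; apply: mo; exact: closed_openC.
by apply: fsbig1 => U /Dnull; rewrite inE => -[].
Qed.

End radon_measures.

Section filter_algebra.
Context {T : Type}.
Implicit Types F : set_system T.

Definition free_filter F : Prop := \bigcap_(A in F) A = set0.

Definition dual_ideal F : set_system T := [set ~` A | A in F].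

Definition filter_algebra F : set_system T := F `|` dual_ideal F.

Lemma filter_ultrafilter_on F (PF : ProperFilter F) :
  ultrafilter_on (filter_algebra F) F.
Proof.
split.
- exact: subsetUl.
- exact: filterT.
- exact: filter_not_empty.
- exact: filterI.
- by move=> A A' FA _ AA'; exact: filterS FA.
- by move=> A [FA|[C FC <-]]; [left|right; rewrite setCK].
Qed.

Lemma filter_algebraT F : Filter F -> filter_algebra F setT.
Proof. by move=> FF; left; exact: filterT. Qed.

Lemma filter_algebraC F : setC_closed (filter_algebra F).
Proof. by move=> A [FA|[C FC <-]]; [right; exists A|left; rewrite setCK]. Qed.

Lemma filter_algebraI F : Filter F -> setI_closed (filter_algebra F).
Proof.
move=> FF.
have dI A C : F A -> filter_algebra F (~` A `&` C).
  move=> FA; right; exists (A `|` ~` C); first exact: filterS FA.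
  by rewrite setCU setCK.
move=> A C [FA|[A' FA' <-]]; last by move=> _; exact: dI.
by case=> [FC|[C' FC' <-]]; [left; exact: filterI|rewrite setIC; exact: dI].
Qed.

(* A copy of the Stone space, pointed because measurable types have to be; the
   choice of the point plays no role in topology, measures or supports. *)
Definition stone_filter F (PF : ProperFilter F) : Type := stone (filter_algebra F).

Definition filter_point F (PF : ProperFilter F) : stone_filter PF :=
  Stone (filter_ultrafilter_on PF).

HB.instance Definition _ F (PF : ProperFilter F) :=
  Topological.copy (stone_filter PF) (stone (filter_algebra F)).
HB.instance Definition _ F (PF : ProperFilter F) :=
  isPointed.Build (stone_filter PF) (filter_point PF).

End filter_algebra.

Section stone_filter_theory.
Context {T : Type} (F : set_system T) (PF : ProperFilter F).

Lemma stone_filter_compact : compact [set: stone_filter PF].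
Proof.
apply: stone_compact; [exact: filter_algebraT|exact: filter_algebraI|].
exact: filter_algebraC.
Qed.

Lemma stone_filter_hausdorff : hausdorff_space (stone_filter PF).
Proof. by apply: stone_hausdorff; exact: filter_algebraC. Qed.

End stone_filter_theory.

Section blowup.
Context {R : realType} {T : ptopologicalType}.
Local Open Scope ereal_scope.

Definition blowup_at (p : T)
    (mu : nat -> finite_borel_measure R T) : Prop :=
  [/\ forall n, ~ supp (mu n) p,
      ereal_sup (range (fun n => mu n setT)) = +oo &
      forall U : set T, clopen U -> U p -> mu n (~` U) @[n --> \oo] --> 0].

Definition disjointly_supported
    (mu : nat -> finite_borel_measure R T) : Prop :=
  trivIset setT (fun n => supp (mu n)).

End blowup.

(* Main.v *)
From HB Require Import structures.
From mathcomp Require Import finmap.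
Require Import Defs.
From mathcomp Require Import lra zify.
Set Implicit Arguments.
Unset Strict Implicit.
Unset Printing Implicit Defensive.
Import Order.TTheory GRing.Theory Num.Theory.
Import numFieldNormedType.Exports.
Local Open Scope classical_set_scope.
Local Open Scope ring_scope.

(** If mu_n blows up at p, then mu_n - mu_n(S) delta_p tends to 0 on clopen sets
    while its norm is at least mu_n(S), which contradicts the Nikodym property.

    Conversely, let m_n tend to 0 on the algebra without being norm bounded. Below
    any B in the dual ideal the algebra is a full power set, so the classical
    Nikodym theorem (a gliding hump argument) bounds the variations |m_n|(B)
    uniformly in n. Hence unboundedness persists outside every member of the ideal,
    and one finds pairwise disjoint B_k in the ideal and indices n_k with
    |m_(n_k)|(B_k) >= (k+1)^2. Rescale |m_(n_k)| restricted to B_k to total mass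
    k+1: its value at a fixed B in the ideal is then O(1/(k+1)). These finitely
    additive measures extend to Radon measures carried by the disjoint clopen sets
    [B_k], which miss p. *)

(** * Variation of finitely additive set functions *)

Section variation.
Context {R : realType} {T : Type}.
Implicit Types (m : set T -> R) (A X : set T).

(** The positive part [m^+] of the Jordan decomposition. *)
Definition pos_variation m A : R := sup [set m X | X in [set X | X `<=` A]].

(* |m| = m^+ + m^- and m = m^+ - m^-. *)
Definition abs_variation m A : R := 2 * pos_variation m A - m A.

Variable m : set T -> R.
Hypothesis mP : algebra_measure setT m.

Lemma additiveU A X : A `&` X = set0 -> m (A `|` X) = m A + m X.
Proof. by case: mP => + _; exact. Qed.

Lemma additive0 : m set0 = 0.
Proof. by have := @additiveU set0 set0; rewrite setI0 setU0 => /(_ erefl); lra. Qed.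

Lemma additiveID A X : m A = m (A `&` X) + m (A `\` X).
Proof.
rewrite -additiveU ?setUIDK//; apply/seteqP; split=> // x [[_ Xx] [_]]; exact.
Qed.

Lemma pos_variation_ub A X : X `<=` A -> m X <= pos_variation m A.
Proof.
move=> XA; apply: ub_le_sup; last by exists X.
case: mP => _ [M mM]; exists M => _ [Y _ <-].
by rewrite (le_trans (ler_norm _))// mM.
Qed.

Lemma pos_variation_le A (c : R) :
  (forall X, X `<=` A -> m X <= c) -> pos_variation m A <= c.
Proof.
move=> Ac; apply: ge_sup => [|_ [X XA <-]]; last exact: Ac.
by exists (m set0), set0.
Qed.

(** A subset of the union is cut by [A] into two competitors, one for each supremum; conversely, the
    union of a competitor in [A] and one in [X] competes for the union. *)
Lemma pos_variationU A X : A `&` X = set0 ->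
  pos_variation m (A `|` X) = pos_variation m A + pos_variation m X.
Proof.
move=> AX; apply/eqP; rewrite eq_le; apply/andP; split.
  apply: pos_variation_le => Y YAX; rewrite (additiveID Y A) lerD//.
    by apply: pos_variation_ub; exact: subIsetr.
  by apply: pos_variation_ub => x [/YAX[]].
rewrite -lerBrDr; apply: pos_variation_le => Y YA.
rewrite lerBrDr -lerBrDl; apply: pos_variation_le => Z ZX.
rewrite lerBrDl -additiveU; first exact/pos_variation_ub/setUSS.
by apply/seteqP; split=> // x [/YA Ax /ZX Xx]; rewrite -AX.
Qed.

Lemma abs_variationU A X : A `&` X = set0 ->
  abs_variation m (A `|` X) = abs_variation m A + abs_variation m X.
Proof. by move=> AX; rewrite /abs_variation pos_variationU// additiveU//; lra. Qed.

Lemma normr_le_abs_variation A : `|m A| <= abs_variation m A.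
Proof.
have p1 : m A <= pos_variation m A by exact: pos_variation_ub.
have p0 : 0 <= pos_variation m A.
  by rewrite -additive0; apply: pos_variation_ub; exact: sub0set.
by rewrite ler_norml /abs_variation; lra.
Qed.

Lemma abs_variation_ge0 A : 0 <= abs_variation m A.
Proof. exact: le_trans (normr_le_abs_variation A). Qed.

Lemma le_abs_variation A X : A `<=` X -> abs_variation m A <= abs_variation m X.
Proof.
move=> AX; rewrite -(setDUK AX) abs_variationU; last exact: setDIK.
by rewrite lerDl abs_variation_ge0.
Qed.

(** The constant 3 is crude: [2 * pos_variation m A] contributes at most [2 * c], and [- m A] at
    most [c]. *)
Lemma abs_variation_le A (c : R) :
  (forall X, X `<=` A -> `|m X| <= c) -> abs_variation m A <= 3 * c.
Proof.
move=> Ac; have p : pos_variation m A <= c.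
  by apply: pos_variation_le => X /Ac; rewrite ler_norml => /andP[].
by have := Ac _ (@subset_refl _ A); rewrite ler_norml /abs_variation; lra.
Qed.

End variation.

(** * Uniform boundedness on a full power set by a gliding hump *)

Section powerset_nikodym.
Context {R : realType} {T : Type}.

(* Infinite sets of indices of this form split into two disjoint ones of the same
   form, so that an additive function is small on one of them. *)
Definition progression (a d : nat) : set nat := [set (a + d * t)%N | t in setT].

Lemma progression_half a d :
  progression a (2 * d) `|` progression (a + d) (2 * d) `<=` progression a d.
Proof.
by move=> _ [[t _ <-]|[t _ <-]]; [exists (2 * t)%N|exists (2 * t).+1] => //; nia.
Qed.

Lemma progression_half_disj a d : (0 < d)%N ->
  progression a (2 * d) `&` progression (a + d) (2 * d) = set0.
Proof.
move=> d0; apply/seteqP; split=> // _ [[t _ <-] [s _]] H; exfalso.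
have : (d * (1 + 2 * s) = d * (2 * t))%N by nia.
by move=> /eqP; rewrite eqn_pmul2l// => /eqP; lia.
Qed.

(** Induction on an integer bound for the variation. The variations of the two disjoint halves add
    up to at most N+2, so one of them is at most N+1; the descent stops at the bound 1. *)
Lemma progression_small (m : set nat -> R) a d : algebra_measure setT m ->
  (0 < d)%N ->
  exists a' d', [/\ (0 < d')%N, progression a' d' `<=` progression a d &
    abs_variation m (progression a' d') <= 1].
Proof.
move=> mP d0.
suff H N : forall a d, (0 < d)%N ->
    abs_variation m (progression a d) <= N.+1%:R ->
  exists a' d', [/\ (0 < d')%N, progression a' d' `<=` progression a d &
    abs_variation m (progression a' d') <= 1].
  apply: (H (Num.truncn (abs_variation m (progression a d)))) => //.
  by apply/ltW; apply: truncnS_gt.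
elim: N => [|N IH] {d0}a {}d d0 le; first by exists a, d; split.

have d20 : (0 < 2 * d)%N by rewrite muln_gt0.
have := le_trans (le_abs_variation mP (@progression_half a d)) le.
rewrite (abs_variationU mP)//; last exact: progression_half_disj.
set x := abs_variation _ _; set y := abs_variation _ _ => xy.
have NS : N.+2%:R = N.+1%:R + 1 :> R by rewrite -natr1.
have N0 : 0 <= N%:R :> R by [].
have N1 : N.+1%:R = N%:R + 1 :> R by rewrite -natr1.
have [xN|xN] := leP x N.+1%:R.
  have [a' [d' [d'0 sub ?]]] := IH _ _ d20 xN; exists a', d'; split=> //.
  by apply: subset_trans sub _ => z ?; apply: progression_half; left.
have yN : y <= N.+1%:R by lra.
have [a' [d' [d'0 sub ?]]] := IH _ _ d20 yN; exists a', d'; split=> //.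
by apply: subset_trans sub _ => z ?; apply: progression_half; right.
Qed.


Lemma normr_initial_segment (l : set nat -> R) (c : nat -> R) (J : set nat) n :
  algebra_measure setT l -> (forall j, `|l [set j]| <= c j) ->
  `|l (J `&` `I_n)| <= \sum_(j < n) c j.
Proof.
move=> lP lc; elim: n => [|n IH].
  by rewrite II0 setI0 (additive0 lP) normr0 big_ord0.
rewrite IIS setIUr (additiveU lP); last first.
  by apply/seteqP; split=> // x [[_ /= xn] [_ xnn]]; move: xn; rewrite xnn/= ltnn.
rewrite big_ord_recr/= (le_trans (ler_normD _ _))// lerD//.
have [Jn|Jn] := pselect (J n).
  by rewrite (_ : _ `&` _ = [set n])//; apply/seteqP; split=> [x []|x ->].
rewrite (_ : _ `&` _ = set0).
  by rewrite (additive0 lP) normr0; exact: le_trans (lc n).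
by apply/seteqP; split=> // x [/[swap] ->].
Qed.

(** Humps n_0 < n_1 < ... are picked so that all indices after n_k lie in a progression on which
    [l n_k] has variation at most 1. For J the set of all n_k, the earlier humps change [l n_k J] by
    at most the sum of [c] and the later ones by at most 1, so [|l n_k J|] exceeds n_k, against
    boundedness on J. *)
Lemma no_gliding_hump (l : nat -> set nat -> R) (c : nat -> R) :
  (forall i, algebra_measure setT (l i)) ->
  (forall J, exists M, forall i, `|l i J| <= M) ->
  (forall i j, `|l i [set j]| <= c j) ->
  ~ forall i, i.+1%:R + \sum_(j < i) c j < `|l i [set i]|.
Proof.
move=> lP lbd lc hump.
(* A state (a, d) stands for a progression whose first term a is the current hump. The next
   progression is taken inside the tail starting at a + d, where [l a] is to be small. The value for
   d = 0 is a dummy. *)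
have [f fP] : {f : nat * nat -> nat * nat & forall s, (0 < s.2)%N ->
    [/\ (0 < (f s).2)%N,
      progression (f s).1 (f s).2 `<=` progression (s.1 + s.2) s.2 &
      abs_variation (l s.1) (progression (f s).1 (f s).2) <= 1]}.
  apply: (@choice _ _ (fun s t => (0 < s.2)%N -> [/\ (0 < t.2)%N,
      progression t.1 t.2 `<=` progression (s.1 + s.2) s.2 &
      abs_variation (l s.1) (progression t.1 t.2) <= 1])) => -[a d]/=.
  have [->|d0] := posnP d; first by exists (0, 0)%N.
  have [a' [d' H]] := progression_small (a + d) (lP a) d0.
  by exists (a', d').
pose s k := iter k f (0, 1)%N.
have s0 k : (0 < (s k).2)%N by elim: k => //= k /fP[].
pose P k := progression (s k).1 (s k).2.
have Pa k : P k (s k).1 by exists 0%N => //; rewrite muln0 addn0.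
have PS k : P k.+1 `<=` progression ((s k).1 + (s k).2) (s k).2.
  by have [] := fP _ (s0 k).
have PSP k : P k.+1 `<=` P k.
  by move=> x /PS[t _ <-]; exists t.+1 => //; nia.
have Pn k j : (k <= j)%N -> P j `<=` P k.
  move=> /subnK <-; elim: (j - k)%N => // i IH.
  by rewrite addSn; exact: subset_trans (PSP _) IH.
have Pgt k x : P k.+1 x -> ((s k).1 < x)%N.
  by move=> /PS[t _ <-]; have := s0 k; nia.
have ale k : (k <= (s k).1)%N.
  by elim: k => // k IH; apply: leq_ltn_trans IH (Pgt _ _ (Pa k.+1)).
pose J := range (fun k => (s k).1).
have [M JM] := lbd J.
pose k := (Num.truncn M).+1; have Mk : M < k%:R by exact: truncnS_gt.
pose n := (s k).1.
have nk : k%:R <= n%:R :> R by rewrite ler_nat ale.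
(* J is cut at the hump n; since the progressions decrease, every later hump lies in [P k.+1]. *)
have JE : J = (J `&` `I_n) `|` ([set n] `|` (J `&` P k.+1)).
  apply/seteqP; split=> [x Jx|x [[]//|[->|[]//]]]; last by exists k.
  have [xn|nx|->] := ltngtP x n; [by left|right;right|by right; left].
  split=> //; case: Jx nx => j _ <-; rewrite /n => nx.
  apply: (Pn k.+1 j); last exact: Pa.
  rewrite ltnNge; apply/negP => jk; move: nx; rewrite ltnNge => /negP; apply.
  have [->//|jk'] := eqVneq j k.
  have {jk' jk} : (j < k)%N by rewrite ltn_neqAle jk'.
  by move=> /Pn/(_ _ (Pa k))/Pgt/ltnW.
have nP x : P k.+1 x -> (n < x)%N by exact: Pgt.
have e : l n J = l n (J `&` `I_n) + (l n [set n] + l n (J `&` P k.+1)).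
  rewrite {1}JE (additiveU (lP n)).
    rewrite (additiveU (lP n))//.
    by apply/seteqP; split=> // x [->] [_ /nP]; rewrite ltnn.
  apply/seteqP; split=> // x [[_ /= xn]] [xnn|[_ /nP]]; last by lia.
  by move: xn; rewrite xnn ltnn.
have h1 := normr_initial_segment J n (lP n) (lc n).
have h2 : `|l n (J `&` P k.+1)| <= 1.
  apply: (le_trans (normr_le_abs_variation (lP n) _)).
  have [_ _] := fP _ (s0 k); apply: le_trans.
  by apply: (le_abs_variation (lP n)); exact: subIsetr.
have := hump n; have := JM n; rewrite e => hJ hn.
have : `|l n [set n]| <= `|l n (J `&` `I_n) + (l n [set n] + l n (J `&` P k.+1))|
    + `|l n (J `&` `I_n)| + `|l n (J `&` P k.+1)|.
  set y := l n _; set x := l n _; set z := l n _.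
  have -> : `|y| = `|(x + (y + z)) - x - z| by congr `|_|; lra.
  by rewrite (le_trans (ler_normB _ _))// lerD2r ler_normB.
move: hJ h1 h2 hn nk Mk; rewrite -(natr1 n); lra.
Qed.

(** If uniform boundedness fails, splitting bad sets repeatedly yields disjoint sets A_k and indices
    n_k with ever larger humps. The functions J |-> m_(n_k)(union of A_j over J) on subsets of [nat]
    then contradict [no_gliding_hump]. *)
Lemma nikodym_powerset (m : nat -> set T -> R) :
  (forall n, algebra_measure setT (m n)) ->
  (forall A, exists M, forall n, `|m n A| <= M) ->
  exists M, forall n A, `|m n A| <= M.
Proof.
move=> mP /choice[c mc]; apply: contrapT => unbd.
pose bad E := forall K, exists n X, X `<=` E /\ K < `|m n X|.
have badT : bad setT.
  move=> K; apply: contrapT => H; apply: unbd; exists K => n A.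
  by rewrite leNgt; apply/negP => mA; apply: H; exists n, A; split.
have badD E X : X `<=` E -> bad E -> bad X \/ bad (E `\` X).
  move=> XE bE; apply: contrapT => /not_orP[].
  move=> /existsNP[K1 H1] /existsNP[K2 H2].
  have [n [Y [YE]]] := bE (K1 + K2); apply/negP; rewrite -leNgt.
  rewrite (additiveID (mP n) Y X) (le_trans (ler_normD _ _))// lerD//.
    rewrite leNgt; apply/negP => K; apply: H1; exists n, (Y `&` X).
    by split=> //; exact: subIsetr.
  rewrite leNgt; apply/negP => K; apply: H2; exists n, (Y `\` X).
  by split=> // x [/YE].
have split_bad (E : set T) K : bad E -> exists n A E',
    [/\ A `<=` E, E' `<=` E, A `&` E' = set0, bad E' & K < `|m n A|].
  (* Since [|m n E|] is at most [c E], the excess [c E] makes both [X] and its complement in [E]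
     exceed K. So whichever of the two stays bad is kept, and the other one serves as the hump. *)
  move=> bE; have [n [X [XE HX]]] := bE (`|K| + c E); exists n.
  have EX : K < `|m n (E `\` X)|.
    have := mc E n; rewrite (additiveID (mP n) E X) (setIidr XE) => h.
    have := lerB_normD (m n X) (m n (E `\` X)).
    by have := ler_norm K; lra.
  have cE : 0 <= c E by exact: le_trans (mc E n).
  have [bX|bX] := badD _ _ XE bE.
    by exists (E `\` X), X; split=> //; exact: setDKI.
  exists X, (E `\` X); split=> //; first exact: setDIK.
  by have := ler_norm K; lra.
have [f fP] : {f : set T * R -> nat * set T * set T & forall s, bad s.1 ->
    [/\ (f s).1.2 `<=` s.1, (f s).2 `<=` s.1, (f s).1.2 `&` (f s).2 = set0,
      bad (f s).2 & s.2 < `|m (f s).1.1 (f s).1.2|]}.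
  apply: (@choice _ _ (fun s t => bad s.1 ->
    [/\ t.1.2 `<=` s.1, t.2 `<=` s.1, t.1.2 `&` t.2 = set0,
      bad t.2 & s.2 < `|m t.1.1 t.1.2|])) => -[E K]/=.
  have [bE|nbE] := pselect (bad E); last by exists (0%N, set0, set0).
  have [n [A [E' H]]] := split_bad E K bE.
  by exists (n, A, E').
(* The real component of the state accumulates the threshold k + 1 + sum of [c (A j)] over j < k
   that the gliding hump requires. *)
pose step s := ((f s).2, s.2 + 1 + c (f s).1.2).
pose s k := iter k step (setT, 1).
have bs k : bad (s k).1 by elim: k => //= k /fP[].
pose A k := (f (s k)).1.2; pose n k := (f (s k)).1.1.
have As k : A k `<=` (s k).1 by have [] := fP _ (bs k).
have sS k : (s k.+1).1 `<=` (s k).1 by have [] := fP _ (bs k).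
have AsS k : A k `&` (s k.+1).1 = set0 by have [] := fP _ (bs k).
have sle k j : (k <= j)%N -> (s j).1 `<=` (s k).1.
  move=> /subnK <-; elim: (j - k)%N => // i IH.
  by rewrite addSn; exact: subset_trans (sS _) IH.
have Adisj j k x : A j x -> A k x -> j = k.
  wlog jk : j k / (j < k)%N => [H Aj Ak|Aj Ak].
    by have [jk|jk|//] := ltngtP j k; [exact: H|symmetry; exact: H].
  have : set0 x by rewrite -(AsS j); split=> //; apply: (sle _ _ jk); exact: As.
  by [].
have sK k : (s k).2 = k.+1%:R + \sum_(j < k) c (A j).
  elim: k => [|k IH]; first by rewrite big_ord0 addr0.
  by rewrite /s iterS -/(s k) /= IH big_ord_recr/= -/(A k) -(natr1 k.+1); lra.
pose l i J := m (n i) (\bigcup_(j in J) A j).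
apply: (@no_gliding_hump l (fun j => c (A j))).
- move=> i; split=> [J J' _ _ JJ'|]; last first.
    by have [_ [M mM]] := mP (n i); exists M => J _; exact: mM.
  rewrite /l bigcup_setU (additiveU (mP _))//; apply/seteqP; split=> // x.
  move=> [[j Jj Aj] [k Jk Ak]]; suff : set0 j by [].
  by rewrite -JJ'; split=> //; rewrite (Adisj _ _ _ Aj Ak).
- by move=> J; eexists => i; exact: mc.
- by move=> i j; rewrite /l bigcup_set1.
- move=> i; rewrite /l bigcup_set1 -sK.
  by have [] := fP _ (bs i).
Qed.

End powerset_nikodym.

(** * Radon extension of finitely additive measures on clopen sets *)

Section clopen_extension.
Context {R : realType} {T : ptopologicalType}.
Variable w : set T -> R.
Hypothesis compactT : compact [set: T].
Hypothesis clopen_base : forall (U : set T) x, open U -> U x ->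
  exists C, [/\ clopen C, C x & C `<=` U].
Hypothesis w_ge0 : forall C, clopen C -> 0 <= w C.
Hypothesis wU : forall C D, clopen C -> clopen D -> C `&` D = set0 ->
  w (C `|` D) = w C + w D.
Local Open Scope ereal_scope.

Let clopenD (C D : set T) : clopen C -> clopen D -> clopen (C `\` D).
Proof. by move=> cC cD; rewrite setDE; apply: clopenI => //; exact: clopenC. Qed.

Lemma clopen_between (K U : set T) : closed K -> open U -> K `<=` U ->
  exists D, [/\ clopen D, K `<=` D & D `<=` U].
Proof.
move=> cK oU KU; have : compact K by exact: (subclosed_compact cK compactT).
rewrite compact_cover => /(_ _ [set C : set T | clopen C /\ C `<=` U] id).
case=> [C [[]]//|x /KU Ux|D DU KD].
  by have [C [cC Cx CU]] := clopen_base oU Ux; exists C.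
exists (\bigcup_(C in [set` D]) C); split=> //.
  rewrite bigcup_fset; rewrite big_seq; elim/big_ind : _ => [||C CD].
  - exact: clopen0.
  - exact: clopenU.
  - by have := DU _ CD; rewrite inE => -[].
by move=> x [C CD]; have := DU _ CD; rewrite inE => -[_]; exact.
Qed.

Let w0 : w set0 = 0%R.
Proof.
by have := wU clopen0 clopen0; rewrite setI0 setU0 => /(_ erefl); lra.
Qed.

Let le_w (C D : set T) : clopen C -> clopen D -> C `<=` D -> (w C <= w D)%R.
Proof.
move=> cC cD CD; rewrite -(setDUK CD) wU; [|by []|exact: clopenD|exact: setDIK].
by rewrite lerDl w_ge0//; exact: clopenD.
Qed.

(** The content [w] is extended in two stages: to open sets by clopen approximation from inside,
    then to all sets by open approximation from outside. *)
Definition inner_content (U : set T) : \bar R :=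
  ereal_sup [set (w C)%:E | C in [set C | clopen C /\ C `<=` U]].

Definition outer_content (A : set T) : \bar R :=
  ereal_inf [set inner_content U | U in [set U | open U /\ A `<=` U]].

Local Notation g := inner_content.
Local Notation mu := outer_content.

Lemma clopen_le_inner C (U : set T) : clopen C -> C `<=` U -> (w C)%:E <= g U.
Proof. by move=> cC CU; apply: ereal_sup_ubound; exists C. Qed.

Lemma le_inner_content (U V : set T) : U `<=` V -> g U <= g V.
Proof.
move=> UV; apply: ge_ereal_sup => _ [C [cC CU] <-].
by apply: clopen_le_inner => //; exact: subset_trans UV.
Qed.

Lemma inner_content_ge0 (U : set T) : 0 <= g U.
Proof. by have := clopen_le_inner clopen0 (@sub0set _ U); rewrite w0. Qed.

Lemma inner_content_clopen C : clopen C -> g C = (w C)%:E.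
Proof.
move=> cC; apply/eqP; rewrite eq_le clopen_le_inner// andbT.
by apply: ge_ereal_sup => _ [D [cD DC] <-]; rewrite lee_fin le_w.
Qed.

(** For clopen [C] inside the union, the closed set [C] minus [V] lies in [U]; a clopen [D] between
    them cuts [C] into a part in [U] and a part in [V]. *)
Lemma inner_contentU (U V : set T) : open U -> open V -> g (U `|` V) <= g U + g V.
Proof.
move=> oU oV; apply: ge_ereal_sup => _ [C [cC CUV] <-].
have [||D [cD KD DU]] := @clopen_between (C `&` ~` V) U _ oU.
- by apply: closedI; [case: cC|exact: open_closedC].
- by move=> x [/CUV[]].
rewrite (_ : C = (C `&` D) `|` (C `\` D)); last by rewrite setUIDK.
rewrite wU; [|exact: clopenI|exact: clopenD|]; last first.
  by apply/seteqP; split=> // x [[_ Dx] [_]]; exact.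
rewrite EFinD; apply: leeD; apply: clopen_le_inner.
- exact: clopenI.
- by apply: subset_trans DU; exact: subIsetr.
- exact: clopenD.
- by move=> x [Cx nDx]; apply: contrapT => nVx; apply: nDx; apply: KD; split.
Qed.

(** A clopen subset of the union is compact, hence covered by finitely many [U n], and finite
    subadditivity applies. *)
Lemma inner_content_bigcup (U : nat -> set T) : (forall n, open (U n)) ->
  g (\bigcup_n U n) <= \sum_(n <oo) g (U n).
Proof.
move=> oU; apply: ge_ereal_sup => _ [C [cC CU] <-].
have : compact C by apply: (subclosed_compact _ compactT) => //; case: cC.
rewrite compact_cover => /(_ _ setT U).
case=> [n _|x /CU//|D _ CD]; first exact: oU.
pose N := (\max_(i <- finmap.enum_fset D) i).+1.
have CN : C `<=` \big[setU/set0]_(i < N) U i.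
  move=> x /CD[i iD Uix]; rewrite -bigcup_mkord; exists i => //=.
  by rewrite ltnS; apply: (@leq_bigmax_seq _ _ xpredT id).
apply: (le_trans (clopen_le_inner cC CN)).
apply: (@le_trans _ _ (\sum_(0 <= i < N) g (U i))); last first.
  by apply: nneseries_lim_ge => n _ _; exact: inner_content_ge0.
rewrite big_mkord; elim: (N) => [|n IH].
  by rewrite !big_ord0 inner_content_clopen ?w0//; exact: clopen0.
rewrite !big_ord_recr/=; apply: le_trans (inner_contentU _ (oU n)) _.
  by rewrite -bigcup_mkord; exact: bigcup_open.
exact: leeD2r.
Qed.

Lemma outer_content_le (A U : set T) : open U -> A `<=` U -> mu A <= g U.
Proof. by move=> oU AU; apply: ereal_inf_lbound; exists U. Qed.

Lemma outer_content_open (U : set T) : open U -> mu U = g U.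
Proof.
move=> oU; apply/eqP; rewrite eq_le outer_content_le//=.
by apply: le_ereal_inf_tmp => _ [V [oV UV] <-]; exact: le_inner_content.
Qed.

Lemma outer_content_clopen C : clopen C -> mu C = (w C)%:E.
Proof.
by move=> cC; rewrite outer_content_open ?inner_content_clopen//; case: cC.
Qed.

Lemma outer_content_ge0 A : 0 <= mu A.
Proof. by apply: le_ereal_inf_tmp => _ [U _ <-]; exact: inner_content_ge0. Qed.

Lemma outer_content0 : mu set0 = 0.
Proof. by rewrite outer_content_clopen ?w0//; exact: clopen0. Qed.

Lemma le_outer_content : {homo mu : A B / A `<=` B >-> A <= B}.
Proof.
move=> A B AB; apply: ereal_inf_le_tmp => _ [U [oU BU] <-].
by exists U => //; split=> //; exact: subset_trans BU.
Qed.

Lemma outer_content_fin_num A : mu A \is a fin_num.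
Proof.
rewrite ge0_fin_numE ?outer_content_ge0//.
apply: (@le_lt_trans _ _ (mu setT)); first exact: le_outer_content.
by rewrite outer_content_clopen ?ltry//; exact: clopenT.
Qed.

Lemma outer_content_sigma_subadditive : sigma_subadditive mu.
Proof.
move=> A; apply/lee_addgt0Pr => e e0.
apply: le_trans (epsilon_trick _ _ (ltW e0)); last first.
  by move=> n; exact: outer_content_ge0.
(* Each [A n] gets an open superset with excess e / 2^(n+1), so the total excess is at most e. *)
have [U UP] : {U : nat -> set T & forall n, [/\ open (U n), A n `<=` U n &
    g (U n) <= mu (A n) + (e / (2 ^ n.+1)%:R)%:E]}.
  apply: (@choice _ _ (fun n V => [/\ open V, A n `<=` V &
    g V <= mu (A n) + (e / (2 ^ n.+1)%:R)%:E])) => n.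
  have en : (0 < e / (2 ^ n.+1)%:R)%R by rewrite divr_gt0// ltr0n expn_gt0.
  have [_ [V [oV AV] <-] /ltW ?] :=
    lb_ereal_inf_adherent en (outer_content_fin_num (A n)).
  by exists V.
apply: (@le_trans _ _ (g (\bigcup_n U n))).
  apply: outer_content_le; first by apply: bigcup_open => n _; case: (UP n).
  by apply: subset_bigcup => n _; case: (UP n).
apply: (@le_trans _ _ (\sum_(n <oo) g (U n))).
  by apply: inner_content_bigcup => n; case: (UP n).
by apply: lee_nneseries => n *; [exact: inner_content_ge0|case: (UP n)].
Qed.

Let om : outer_measure R T := HB.pack mu (isOuterMeasure.Build R T mu
  outer_content0 outer_content_ge0 le_outer_content
  outer_content_sigma_subadditive).

(** The test set may be replaced by an open [V]. Approximate the trace of [V] on [U] from inside by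
    a clopen [C], then the rest of [V] off [C], which contains [V] minus [U], by a clopen [D]. As
    [C] and [D] are disjoint in [V], [w C + w D] is at most the content of [V]. *)
Lemma open_caratheodory (U : set T) : open U -> om.-caratheodory U.
Proof.
move=> oU; apply: le_caratheodory_measurable => X.
apply: le_ereal_inf_tmp => _ [V [oV XV] <-] /=.
apply: (@le_trans _ _ (mu (V `&` U) + mu (V `&` ~` U))).
  by apply: leeD; apply: le_outer_content; exact: setSI.
rewrite (outer_content_open (openI oV oU)) -leeBrDr ?outer_content_fin_num//.
apply: ge_ereal_sup => _ [C [cC CVU] <-].
rewrite leeBrDr ?outer_content_fin_num//.
apply: (@le_trans _ _ ((w C)%:E + g (V `\` C))).
  rewrite leeD2l//; apply: outer_content_le.
    by rewrite setDE; apply: openI => //; case: cC => _; exact: closed_openC.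
  by move=> x [Vx nUx]; split=> // /CVU[].
rewrite addeC -leeBrDr//; apply: ge_ereal_sup => _ [D [cD DVC] <-].
rewrite leeBrDr// -EFinD -wU//; last first.
  by apply/seteqP; split=> // x [/DVC[]].
apply: clopen_le_inner; first exact: clopenU.
by move=> x [/DVC[]|/CVU[]].
Qed.

Let borelT : measurableType _ := g_sigma_algebraType (@open T).

Lemma borel_caratheodory (A : set borelT) : measurable A -> om.-caratheodory A.
Proof.
move=> mA; suff: <<s @open T >> `<=` om.-caratheodory by exact.
apply: smallest_sub => [|U]; last exact: open_caratheodory.
split.
- exact: caratheodory_measurable_set0.
- by move=> X mX; rewrite setTD; exact: caratheodory_measurable_setC.
- by move=> X mX; exact: caratheodory_measurable_bigcup.
Qed.

Let mu_semi_sigma_additive : semi_sigma_additive (mu : set borelT -> \bar R).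
Proof.
move=> A mA tA mUA; apply: (@caratheodory_measure_sigma_additive _ _ om) => //.
- by move=> n; exact: borel_caratheodory.
- exact: borel_caratheodory.
Qed.

Let mu_measure : {measure set borelT -> \bar R} :=
  HB.pack (mu : set borelT -> \bar R)
    (isMeasure.Build _ _ _ (mu : set borelT -> \bar R)
       outer_content0 outer_content_ge0 mu_semi_sigma_additive).

Let mu_fin_num : fin_num_fun mu_measure.
Proof. by move=> A _; exact: outer_content_fin_num. Qed.

Let mu_finite : {finite_measure set borelT -> \bar R} :=
  HB.pack (Measure.sort mu_measure)
    (Measure_isFinite.Build _ _ _ mu_measure mu_fin_num).

Lemma radon_extension : exists nu : finite_borel_measure R T,
  radon nu /\ forall C, clopen C -> nu C = (w C)%:E.
Proof.
exists mu_finite; split=> [A mA|]; last exact: outer_content_clopen.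
have oe (U : set T) : open U -> mu_finite U = g U by exact: outer_content_open.
split; last first.
  congr ereal_inf; apply/seteqP; split=> _ [U [oU AU] <-]; exists U => //;
    by rewrite oe.
have mo (U : set T) : open U -> measurable (U : set borelT).
  by move=> oU; exact: sub_sigma_algebra.
have muC (B : set borelT) : measurable B -> mu (~` B) = mu setT - mu B.
  move=> mB; have /(_ setT) := borel_caratheodory mB; rewrite /= !setTI => ->.
  by rewrite addeAC subee ?add0e// outer_content_fin_num.
apply/eqP; rewrite eq_le; apply/andP; split; last first.
  by apply: ge_ereal_sup => _ [K [cK KA] <-]; exact: le_outer_content.
apply/lee_addgt0Pr => e e0.
have [_ [U [oU AU] <-] /ltW gU] :=
  lb_ereal_inf_adherent e0 (outer_content_fin_num (~` A)).
apply: (@le_trans _ _ (mu (~` U) + e%:E)); last first.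
  rewrite leeD2r//; apply: ereal_sup_ubound; exists (~` U) => //.
  by split; [exact: open_closedC|rewrite -(setCK A); exact: subsetC].
rewrite /= -[in leLHS](setCK A) muC; last exact: measurableC.
rewrite (muC U (mo _ oU)).
move: gU; rewrite -/(mu (~` A)) -outer_content_open//.
rewrite -(fineK (outer_content_fin_num setT)) -(fineK (outer_content_fin_num U)).
rewrite -(fineK (outer_content_fin_num (~` A))).
by rewrite -!EFinN -!EFinD !lee_fin; lra.
Qed.

End clopen_extension.

(** * The algebra of a filter and its Stone space *)

Section variation_norm_bound.
Context {R : realType} {T : Type} (B : set_system T) (m : set T -> R).
Hypotheses (B0 : B set0) (BU : setU_closed B).
Hypothesis mU : forall A A', B A -> B A' -> A `&` A' = set0 ->
  m (A `|` A') = m A + m A'.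

Let m0 : m set0 = 0.
Proof. by have := mU B0 B0; rewrite setI0 setU0 => /(_ erefl); lra. Qed.

Lemma algebra_additive_sum (I : choiceType) (A : I -> set T) (r : seq I) : uniq r ->
  (forall i, B (A i)) -> trivIset setT A ->
  B (\big[setU/set0]_(i <- r) A i) /\
  m (\big[setU/set0]_(i <- r) A i) = \sum_(i <- r) m (A i).
Proof.
move=> + BA tA; elim: r => [|i r IH] /= => [_|/andP[ir /IH[Br mr]]].
  by rewrite !big_nil.
rewrite !big_cons; split; first exact: BU.
rewrite mU//; first by rewrite mr.
apply/seteqP; split=> // x [Aix]; rewrite -bigcup_seq => -[j /= jr Ajx].
have ij : i = j by apply: tA => //; exists x.
by move: ir; rewrite ij jr.
Qed.

(** The pieces with non-negative value and those with negative value are united separately; both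
    unions belong to [B], and each accounts for at most [M]. *)
Lemma variation_norm_le (M : R) : (forall A, B A -> `|m A| <= M) ->
  (variation_norm B m <= (2 * M)%:E)%E.
Proof.
move=> mM; apply: ge_ereal_sup => _ [n [A [BA tA ->]]]; rewrite lee_fin.
pose Ap i := if 0 <= m (A i) then A i else set0.
pose An i := if 0 <= m (A i) then set0 else A i.
have tp : trivIset setT Ap.
  move=> i j _ _ [x []]; rewrite /Ap; case: ifP => // _ Ai; case: ifP => // _ Aj.
  by apply: tA => //; exists x.
have tn : trivIset setT An.
  move=> i j _ _ [x []]; rewrite /An; case: ifP => // _ Ai; case: ifP => // _ Aj.
  by apply: tA => //; exists x.
have Bp i : B (Ap i) by rewrite /Ap; case: ifP.
have Bn i : B (An i) by rewrite /An; case: ifP.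
have [BP mP] := algebra_additive_sum (index_enum_uniq 'I_n) Bp tp.
have [BN mN] := algebra_additive_sum (index_enum_uniq 'I_n) Bn tn.
have -> : \sum_(i < n) `|m (A i)| = \sum_(i < n) m (Ap i) - \sum_(i < n) m (An i).
  rewrite -sumrB; apply: eq_bigr => i _; rewrite /Ap /An.
  case: ifPn => [h|]; first by rewrite ger0_norm// m0 subr0.
  by rewrite -ltNge => h; rewrite ltr0_norm// m0 sub0r.
rewrite -mP -mN; have := mM _ BP; have := mM _ BN; rewrite !ler_norml; lra.
Qed.

End variation_norm_bound.

Section stone_filter_topology.
Context {T : Type} (F : set_system T) (PF : ProperFilter F).

Lemma dual_idealE A : dual_ideal F A <-> F (~` A).
Proof.
split=> [[C FC <-]|FA]; first by rewrite setCK.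
by exists (~` A) => //; rewrite setCK.
Qed.

Lemma sub_dual_ideal A B : A `<=` B -> dual_ideal F B -> dual_ideal F A.
Proof. by move=> AB; rewrite !dual_idealE; apply: filterS; exact: subsetC. Qed.

Lemma dual_idealU A B : dual_ideal F A -> dual_ideal F B -> dual_ideal F (A `|` B).
Proof. by rewrite !dual_idealE setCU; exact: filterI. Qed.

Lemma not_filter_dual A : F A -> ~ dual_ideal F A.
Proof.
move=> FA; rewrite dual_idealE => FCA; apply: (filter_not_empty F).
by rewrite -(setICr A); exact: filterI.
Qed.

Lemma filter_algebraU : setU_closed (filter_algebra F).
Proof.
move=> A B BA BB; rewrite -(setCK (_ `|` _)) setCU.
by apply/filter_algebraC/filter_algebraI; exact: filter_algebraC.
Qed.

Lemma stone_filter_base (U : set (stone_filter PF)) x : open U -> U x ->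
  exists A, [/\ filter_algebra F A, stone_ultra x A &
    (stone_clopen A : set (stone_filter PF)) `<=` U].
Proof.
move=> [D DB <-] [A DA Ax]; exists A; split=> //; first exact: DB.
by move=> y Ay; exists A.
Qed.

Lemma stone_filter_clopen A : filter_algebra F A ->
  clopen (stone_clopen A : set (stone_filter PF)).
Proof. exact: (stone_clopenP (@filter_algebraC _ F)). Qed.

Lemma stone_filter_clopen_base (U : set (stone_filter PF)) x : open U -> U x ->
  exists C, [/\ clopen C, C x & C `<=` U].
Proof.
move=> oU Ux; have [A [BA Ax AU]] := stone_filter_base oU Ux.
by exists (stone_clopen A); split=> //; exact: stone_filter_clopen.
Qed.

Lemma stone_clopenI0 A B : A `&` B = set0 ->
  (stone_clopen A : set (stone_filter PF)) `&` stone_clopen B = set0.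
Proof.
move=> AB; apply/seteqP; split=> // u [uA uB].
apply: (ultra_on0 (stone_ultraP u)); rewrite -AB.
exact: (ultra_onI (stone_ultraP u)).
Qed.

Lemma stone_clopen_setC A : filter_algebra F A ->
  (stone_clopen (~` A) : set (stone_filter PF)) = ~` stone_clopen A.
Proof.
move=> BA; apply/seteqP; split=> [u uCA uA|u nuA].
  by have : set0 u by rewrite -(stone_clopenI0 (setICr A)); split.
by case: (ultra_onC (stone_ultraP u) BA).
Qed.

Lemma stone_clopen_setU A B : filter_algebra F A -> filter_algebra F B ->
  (stone_clopen (A `|` B) : set (stone_filter PF)) =
  stone_clopen A `|` stone_clopen B.
Proof.
move=> BA BB; have BAB := filter_algebraU BA BB.
apply/seteqP; split=> [u uAB|u [uA|uB]].
- apply: contrapT => /not_orP[nA nB].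
  have uCA : stone_clopen (~` A) u by rewrite stone_clopen_setC.
  have uCB : stone_clopen (~` B) u by rewrite stone_clopen_setC.
  have : (~` stone_clopen (A `|` B) : set (stone_filter PF)) u; last exact.
  rewrite -stone_clopen_setC// setCU.
  exact: (ultra_onI (stone_ultraP u) uCA uCB).
- by apply: (ultra_onS (stone_ultraP u) uA) => //; exact: subsetUl.
- by apply: (ultra_onS (stone_ultraP u) uB) => //; exact: subsetUr.
Qed.

Lemma principal_ultrafilter_on (x : T) :
  ultrafilter_on (filter_algebra F) [set A | filter_algebra F A /\ A x].
Proof.
split=> //=.
- by move=> A [].
- by split=> //; exact: filter_algebraT.
- by move=> [].
- by move=> A B [BA Ax] [BB Bx]; split=> //; exact: filter_algebraI.
- by move=> A B [_ Ax] BB AB; split=> //; exact: AB.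
- move=> A BA; have [Ax|nAx] := pselect (A x); [left|right] => //.
  by split=> //; exact: filter_algebraC.
Qed.

(** Maps [T] into the Stone space. Preimages under it turn clopen sets into subsets of [T], so an
    additive function of all subsets of [T] induces a content on clopen sets without any prior
    description of these. *)
Definition principal_point (x : T) : stone_filter PF :=
  Stone (principal_ultrafilter_on x).

Lemma principal_point_stone_clopen A : filter_algebra F A ->
  principal_point @^-1` stone_clopen A = A.
Proof. by move=> BA; apply/seteqP; split=> [x []|x Ax]//; split. Qed.

Lemma filter_trace (U : set (stone_filter PF)) : open U -> U (filter_point PF) ->
  F (principal_point @^-1` U).
Proof.
move=> oU Up; have [A [BA /= FA AU]] := stone_filter_base oU Up.
by apply: filterS FA => x Ax; apply: AU; split.
Qed.

End stone_filter_topology.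

(** * Blow-ups at the filter point and the Nikodym property *)

Section blowup_nikodym.
Context {R : realType} {T : Type} (F : set_system T) (PF : ProperFilter F).
Local Notation S := (stone_filter PF).
Local Notation cl A := (stone_clopen A : set S).

Lemma nikodym_no_blowup : nikodym R (filter_algebra F) ->
  ~ exists mu : nat -> finite_borel_measure R S, blowup_at (filter_point PF) mu.
Proof.
move=> nik [mu [supp_mu sup_mu lim_mu]].
have mcl A : filter_algebra F A ->
    measurable (cl A : set (g_sigma_algebraType (@open S))).
  by move=> /(stone_filter_clopen PF)[oA _]; exact: sub_sigma_algebra.
have fn n (X : set S) : measurable (X : set (g_sigma_algebraType (@open S))) ->
    mu n X \is a fin_num by exact: fin_num_measure.
have fnT n : mu n setT \is a fin_num by exact: fin_num_measure.
(* The signed measure [mu n - mu n(S) delta_p] read on the algebra: p lies in [cl A] exactly when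
   [F A]. *)
pose m n A : R := fine (mu n (cl A)) - (if `[< F A >] then fine (mu n setT) else 0).
have mC n A : filter_algebra F A ->
    fine (mu n (cl A)) = fine (mu n setT) - fine (mu n (~` cl A)).
  move=> BA; apply/eqP; rewrite eq_sym subr_eq; apply/eqP.
  have mA := mcl A BA; have mA' := measurableC mA.
  rewrite -fineD; [|exact: fn|exact: fn].
  by rewrite -measureU ?setUCr ?setICr.
have mF n A : F A -> m n A = - fine (mu n (~` cl A)).
  by move=> FA; rewrite /m asboolT// mC; [lra|left].
have mD n A : dual_ideal F A -> m n A = fine (mu n (cl A)).
  by move=> DA; rewrite /m asboolF ?subr0// => /(not_filter_dual PF).
have [||M mM] := nik m.
- move=> n; split=> [A A' BA BA' AA'|].
    have -> : m n (A `|` A') =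
        fine (mu n (cl A)) + fine (mu n (cl A')) -
        (if `[< F (A `|` A') >] then fine (mu n setT) else 0).
      have mA := mcl A BA; have mA' := mcl A' BA'.
      rewrite /m -fineD; [|exact: fn|exact: fn].
      by rewrite stone_clopen_setU// measureU//; exact: stone_clopenI0.
    have [FA|nFA] := pselect (F A).
      have nFA' : ~ F A'.
        move=> FA'; apply: (filter_not_empty F).
        by rewrite -AA'; exact: filterI.
      have FU : F (A `|` A') by apply: filterS FA; exact: subsetUl.
      by rewrite /m (asboolT FA) (asboolT FU) (asboolF nFA'); lra.
    case: BA => // DA.
    have [FA'|nFA'] := pselect (F A').
      have FU : F (A `|` A') by apply: filterS FA'; exact: subsetUr.
      by rewrite /m (asboolT FA') (asboolT FU) (asboolF nFA); lra.
    case: BA' => // DA'.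
    rewrite /m (asboolF nFA) (asboolF nFA') asboolF; first by lra.
    by move=> /(not_filter_dual PF); apply; exact: dual_idealU.
  exists (fine (mu n setT)) => A BA.
  have le1 X : measurable (X : set (g_sigma_algebraType (@open S))) ->
      0 <= fine (mu n X) <= fine (mu n setT).
    move=> mX; rewrite fine_ge0//= fine_le ?fn//.
    by apply: le_measure; rewrite ?inE.
  case: BA => [FA|DA].
    rewrite mF// normrN ger0_norm; last by rewrite fine_ge0.
    by have /andP[] := le1 _ (measurableC (mcl A (or_introl FA))).
  rewrite mD// ger0_norm; last by rewrite fine_ge0.
  by have /andP[] := le1 _ (mcl A (or_intror DA)).
- have lim0 (U : set S) : clopen U -> U (filter_point PF) ->
      fine (mu n (~` U)) @[n --> \oo] --> (0 : R).
    by move=> cU Up; apply: fine_cvg; exact: lim_mu.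
  move=> A [FA|DA].
    have -> : (fun n => m n A) = (fun n => - fine (mu n (~` cl A))).
      by apply/funext => n; rewrite mF.
    rewrite -oppr0; apply: cvgN; apply: lim0 => //.
    by apply: stone_filter_clopen; left.
  have -> : (fun n => m n A) = (fun n => fine (mu n (~` cl (~` A)))).
    by apply/funext => n; rewrite mD// stone_clopen_setC ?setCK//; right.
  have FCA : F (~` A) by rewrite -dual_idealE.
  by apply: lim0 => //; apply: stone_filter_clopen; left.
suff : (ereal_sup (range (fun n => mu n setT)) <= M%:E)%E by rewrite sup_mu.
apply: ge_ereal_sup => _ [n _ <-].
have /existsNP[C /not_implyP[[cC C0] nCp]] := supp_mu n.
have [A [BA /= FA AC]] := stone_filter_base (closed_openC cC) nCp.
have DCA : dual_ideal F (~` A) by rewrite dual_idealE setCK.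
have A0 : mu n (cl A) = 0%E.
  apply/eqP; rewrite eq_le measure_ge0 andbT -C0; apply: le_measure => //.
    by rewrite inE; exact: mcl.
  by rewrite inE; apply: sub_sigma_algebra; exact: closed_openC.
apply: le_trans (mM n); apply: ereal_sup_ubound.
exists 1%N, (fun=> ~` A); split=> [i||]; first by right.
  by move=> i j _ _ _; rewrite !ord1.
rewrite big_ord1 mD// -(fineK (fnT n)); congr _%:E.
rewrite mC; last by right.
by rewrite stone_clopen_setC// setCK A0 subr0 ger0_norm// fine_ge0.
Qed.


Lemma radon_of_additive (w : set T -> R) : (forall A, 0 <= w A) ->
  (forall A B, A `&` B = set0 -> w (A `|` B) = w A + w B) ->
  exists nu : finite_borel_measure R S, radon nu /\
    forall C, clopen C -> nu C = (w (@principal_point _ _ PF @^-1` C))%:E.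
Proof.
move=> w0 wU.
apply: (@radon_extension R S (fun C => w (@principal_point _ _ PF @^-1` C))) => //.
- exact: stone_filter_compact.
- exact: stone_filter_clopen_base.
- by move=> C D _ _ CD; rewrite preimage_setU wU// -preimage_setI CD preimage_set0.
Qed.

(** Every subset of a member of the ideal is again in the ideal, so localizing to [B] makes [m]
    defined and additive on the full power set. *)
Lemma algebra_measure_setI (m : set T -> R) (B : set T) :
  algebra_measure (filter_algebra F) m -> dual_ideal F B ->
  algebra_measure setT (fun A => m (A `&` B)).
Proof.
move=> [mU [M mM]] DB.
have DI A : filter_algebra F (A `&` B) by right; exact: sub_dual_ideal DB.
split=> [A A' _ _ AA'|]; last by exists M => A _; exact: mM.
by rewrite setIUl mU// setIACA AA' set0I.
Qed.

(** Convergence gives boundedness at each set, which [nikodym_powerset] turns into a uniform bound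
    below [B]. *)
Lemma dual_ideal_bounded (m : nat -> set T -> R) (B : set T) :
  (forall n, algebra_measure (filter_algebra F) (m n)) ->
  (forall A, filter_algebra F A -> m n A @[n --> \oo] --> (0 : R)) ->
  dual_ideal F B -> exists c, forall n A, `|m n (A `&` B)| <= c.
Proof.
move=> mP m0 DB.
apply: (@nikodym_powerset _ _ (fun n A => m n (A `&` B))).
  by move=> n; exact: algebra_measure_setI.
move=> A; have : bounded_fun (fun n => m n (A `&` B)).
  apply: cvg_seq_bounded; apply/cvg_ex; exists 0; apply: m0.
  by right; exact: sub_dual_ideal DB.
move=> [M [_ /(_ (M + 1))]] H; exists (M + 1) => n.
by apply: H => //; rewrite ltrDl.
Qed.

Lemma unbounded_blowup (m : nat -> set T -> R) :
  (forall n, algebra_measure (filter_algebra F) (m n)) ->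
  (forall A, filter_algebra F A -> m n A @[n --> \oo] --> (0 : R)) ->
  (forall K, exists n B, dual_ideal F B /\ K < `|m n B|) ->
  exists mu : nat -> finite_borel_measure R S,
    [/\ forall n, radon (mu n), disjointly_supported mu &
        blowup_at (filter_point PF) mu].
Proof.
move=> mP m0 unbd.
have [c cP] : {c : set T -> R & forall B, dual_ideal F B ->
    forall n A, `|m n (A `&` B)| <= c B}.
  apply: (@choice _ _ (fun B c => dual_ideal F B ->
    forall n A, `|m n (A `&` B)| <= c)) => B.
  have [DB|nDB] := pselect (dual_ideal F B); last by exists 0.
  by have [c H] := dual_ideal_bounded mP m0 DB; exists c.
(* In a state (k, C), [C] is the union of the pieces chosen before stage k; the map returns an index
   and a new piece disjoint from [C]. *)
have [f fP] : {f : nat * set T -> nat * set T & forall s, dual_ideal F s.2 ->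
    [/\ dual_ideal F (f s).2, (f s).2 `&` s.2 = set0 &
      s.1.+1%:R ^+ 2 <= `|m (f s).1 (f s).2|]}.
  apply: (@choice _ _ (fun s t => dual_ideal F s.2 ->
    [/\ dual_ideal F t.2, t.2 `&` s.2 = set0 &
      s.1.+1%:R ^+ 2 <= `|m t.1 t.2|])) => -[k C] /=.
  have [DC|nDC] := pselect (dual_ideal F C); last by exists (0%N, set0).
  (* Removing [C] from [B] costs at most [c C], so the threshold leaves (k+1)^2 on the
     difference. *)
  have [n [B [DB KB]]] := unbd (k.+1%:R ^+ 2 + c C).
  have DBC : dual_ideal F (B `\` C) by apply: sub_dual_ideal DB => x [].
  have DIC : dual_ideal F (B `&` C) by apply: sub_dual_ideal DB => x [].
  exists (n, B `\` C) => _ /=; split=> //; first exact: setDKI.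
  have mB : m n B = m n (B `&` C) + m n (B `\` C).
    have [mU _] := mP n; rewrite -mU ?setUIDK//; [by right|by right|].
    by apply/seteqP; split=> // x [[_ Cx] [_]]; exact.
  have := cP _ DC n B; have := ler_normD (m n (B `&` C)) (m n (B `\` C)).
  by rewrite -mB; lra.
pose fix C k := if k is k'.+1 then C k' `|` (f (k', C k')).2 else set0.
have DC k : dual_ideal F (C k).
  elim: k => [|k IH] /=; first by rewrite dual_idealE setC0; exact: filterT.
  by apply: dual_idealU => //; have [] := fP (k, C k) IH.
pose B k := (f (k, C k)).2; pose n k := (f (k, C k)).1.
have DB k : dual_ideal F (B k) by have [] := fP _ (DC k : dual_ideal F (k, C k).2).
have BC k : B k `&` C k = set0 by have [] := fP _ (DC k : dual_ideal F (k, C k).2).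
have mB k : k.+1%:R ^+ 2 <= `|m (n k) (B k)|.
  by have [] := fP _ (DC k : dual_ideal F (k, C k).2).
have BsubC j k : (j < k)%N -> B j `<=` C k.
  elim: k => // k IH; rewrite ltnS leq_eqVlt => /predU1P[->|/IH jk] x Bx.
    by right.
  by left; exact: jk.
have Bdisj j k : (j < k)%N -> B j `&` B k = set0.
  by move=> /BsubC jk; apply/seteqP; split=> // x [/jk Cx Bx]; rewrite -(BC k).
pose l k A := m (n k) (A `&` B k).
have lP k : algebra_measure setT (l k) by exact: algebra_measure_setI.
pose v k := abs_variation (l k).
have vT k : k.+1%:R ^+ 2 <= v k setT.
  by apply: le_trans (normr_le_abs_variation (lP k) _); rewrite /l setTI.
have vT0 k : 0 < v k setT by apply: lt_le_trans (vT k); rewrite exprn_gt0.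
have v_le k A : dual_ideal F A -> v k A <= 3 * c A.
  move=> DA; apply: abs_variation_le => X XA.
  by rewrite /l -(setIidl XA) setIAC; exact: cP.
have vC k : v k (~` B k) = 0.
  apply/eqP; rewrite eq_le (abs_variation_ge0 (lP k)) andbT.
  rewrite -[leRHS](mulr0 3); apply: abs_variation_le => X XB.
  have XB0 : X `&` B k = set0 by apply/seteqP; split=> // x [/XB].
  by rewrite /l XB0 -(set0I (B k)) -/(l k set0) (additive0 (lP k)) normr0.
(* Rescaling to total mass k+1. Since [v k setT] is at least (k+1)^2, the factor is at most 1/(k+1),
   which beats the uniform bound [3 * c A] on each member of the ideal. *)
pose w k A := k.+1%:R / v k setT * v k A.
have wT k : w k setT = k.+1%:R by rewrite /w divfK// gt_eqF.
have w_ge0 k A : 0 <= w k A.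
  by rewrite mulr_ge0 ?divr_ge0 ?(abs_variation_ge0 (lP k))// ltW.
have w_le k A : dual_ideal F A -> w k A <= 3 * c A * k.+1%:R^-1.
  move=> DA; have cA : 0 <= 3 * c A.
    by apply: le_trans (v_le k A DA); exact: abs_variation_ge0 (lP k) A.
  rewrite /w [leRHS]mulrC; apply: ler_pM => //.
  - by rewrite divr_ge0// ltW.
  - exact: abs_variation_ge0 (lP k) A.
  - rewrite ler_pdivrMr// mulrC ler_pdivlMr// -expr2.
    exact: vT.
  - exact: v_le.
have /choice[mu muP] : forall k, exists nu : finite_borel_measure R S, radon nu /\
    forall C, clopen C -> nu C = (w k (@principal_point _ _ PF @^-1` C))%:E.
  move=> k; apply: radon_of_additive => // A A' AA'.
  by rewrite /w /v (abs_variationU (lP k))// mulrDr.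
have muE k U : clopen U -> mu k U = (w k (@principal_point _ _ PF @^-1` U))%:E.
  by have [_] := muP k; exact.
have supp_sub k : supp (mu k) `<=` cl (B k).
  have cB : clopen (cl (B k)) by apply: stone_filter_clopen; right.
  apply: bigcap_inf; split; first by case: cB.
  rewrite -stone_clopen_setC; last by right.
  rewrite muE; last by apply: stone_filter_clopen; left; rewrite -dual_idealE.
  rewrite principal_point_stone_clopen; last by left; rewrite -dual_idealE.
  by rewrite /w vC mulr0.
exists mu; split.
- by move=> k; have [] := muP k.
- apply: ltn_trivIset => j k jk; rewrite setIC; apply/seteqP; split=> // u [].
  move=> /supp_sub uB /supp_sub uB'.
  by rewrite -(stone_clopenI0 PF (Bdisj _ _ jk)).
split.
- by move=> k /supp_sub /= FB; exact: not_filter_dual (DB k).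
- apply: eq_infty => r; pose k := Num.truncn r.
  apply: le_ereal_sup_tmp; exists (mu k setT) => //.
  rewrite muE; last exact: clopenT.
  by rewrite preimage_setT wT lee_fin ltW// truncnS_gt.
(* The trace of [U] on [T] lies in [F], so that of its complement lies in the ideal, where [w k] is
   O(1/(k+1)). *)
- move=> U cU Up; pose D := @principal_point _ _ PF @^-1` (~` U).
  have DD : dual_ideal F D.
    rewrite dual_idealE /D -preimage_setC setCK.
    by apply: filter_trace => //; case: cU.
  have -> : (fun k => mu k (~` U)) = (fun k => (w k D)%:E).
    by apply/funext => k; rewrite muE//; exact: clopenC.
  apply: cvg_EFin; first exact: nearW.
  apply: (@squeeze_cvgr _ _ _ _ (cst 0) (fun k => 3 * c D * k.+1%:R^-1)).
  + by apply: nearW => k; rewrite w_ge0 w_le.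
  + exact: cvg_cst.
  + by rewrite -[X in _ --> X](mulr0 (3 * c D)); apply: cvgMl_tmp; exact: cvg_harmonic.
Qed.

Lemma no_disjoint_blowup_nikodym :
  ~ (exists mu : nat -> finite_borel_measure R S,
      [/\ forall n, radon (mu n), disjointly_supported mu &
          blowup_at (filter_point PF) mu]) ->
  nikodym R (filter_algebra F).
Proof.
move=> nomu m mP m0.
have [K mK] : exists K, forall n B, dual_ideal F B -> `|m n B| <= K.
  apply: contrapT => H; apply: nomu; apply: (unbounded_blowup mP m0) => K.
  apply: contrapT => H'; apply: H; exists K => n B DB.
  by rewrite leNgt; apply/negP => KB; apply: H'; exists n, B.
have [M mT] : exists M, forall n, `|m n setT| <= M.
  have : bounded_fun (fun n => m n setT).
    apply: cvg_seq_bounded; apply/cvg_ex; exists 0; apply: m0.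
    exact: filter_algebraT.
  move=> [M [_ /(_ (M + 1))]] H; exists (M + 1) => n.
  by apply: H => //; rewrite ltrDl.
(* [K] bounds the values on the ideal. For [A] in [F], [m n A] is [m n setT] minus the value at a
   member of the ideal, hence at most [K + M] in absolute value; the factor 2 comes from
   [variation_norm_le]. *)
exists (2 * (K + M)) => n.
have [mU _] := mP n.
have K0 : 0 <= M by exact: le_trans (mT n).
apply: variation_norm_le => //.
- by right; rewrite dual_idealE setC0; exact: filterT.
- exact: filter_algebraU.
move=> A [FA|DA]; last by have := mK n _ DA; lra.
have DCA : dual_ideal F (~` A) by rewrite dual_idealE setCK.
have := mU A (~` A) (or_introl FA) (or_intror DCA) (setICr A).
rewrite setUCr => e; have := mT n; have := mK n _ DCA.
by rewrite !ler_norml; lra.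
Qed.

End blowup_nikodym.

Theorem theoremC (R : realType) (F : set_system nat) (PF : ProperFilter F)
    (freeF : free_filter F) :
  [<-> nikodym R (filter_algebra F) ;
       ~ exists mu : nat -> finite_borel_measure R (stone_filter PF),
         (forall n, radon (mu n)) /\ blowup_at (filter_point PF) mu ;
       ~ exists mu : nat -> finite_borel_measure R (stone_filter PF),
         [/\ forall n, radon (mu n), disjointly_supported mu &
             blowup_at (filter_point PF) mu] ].
Proof.
tfae.
- by move=> nik [mu [_ bmu]]; apply: (@nikodym_no_blowup _ _ _ PF nik); exists mu.
- by move=> nob [mu [rmu _ bmu]]; apply: nob; exists mu.
- exact: no_disjoint_blowup_nikodym.
Qed.
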